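(* Let $\Lambda=\{\lambda_1,\dots,\lambda_d\}\subset\mathbb{C}$ be a nice basis, let $0<\alpha\le 1/2$, and for a positive integer $n$ let $$P=A_{n^{\alpha}}(\Lambda)\times A_{n^{1-\alpha}}(\Lambda)\subset\mathbb{C}^2 .$$ Then there exist constants $C'>0$ and $c>0$, depending only on $d$ and $\Lambda$, such that for every positive integer $n$ and every positive integer $r$ with $r\le C'n^{\alpha}$, the set $P$ determines at least $c\,n^2/r^3$ distinct $r$-rich lines.
   Context: A finite set $\Lambda=\{\lambda_1,\dots,\lambda_d\}\subset\mathbb{C}$ which is linearly independent over $\mathbb{Z}$ is called a nice basis (of degree $d$) if for all $1\le i,j\le d$ the product $\lambda_i\lambda_j$ is a $\mathbb{Z}$-linear combination of $\lambda_1,\dots,\lambda_d$. For a real number $m>0$, $$A_m(\Lambda):=\Big\{a_1\lambda_1+\dots+a_d\lambda_d:\ a_i\in\mathbb{Z},\ |a_i|\le \tfrac{m^{1/d}}{3}\Big\}.$$ A line is a complex affine line in $\mathbb{C}^2$; a line is $r$-rich (with respect to $P$) if it contains at least $r$ points of $P$. *)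

(* Defs.v *)
From mathcomp Require Import all_boot all_order all_algebra.
From mathcomp Require Import all_classical all_reals all_analysis.
From mathcomp Require Import complex.
Set Implicit Arguments.
Unset Strict Implicit.
Unset Printing Implicit Defensive.
Import Order.TTheory GRing.Theory Num.Theory.
Local Open Scope classical_set_scope.
Local Open Scope ring_scope.

Definition zcomb (V : zmodType) (d : nat) (lam : 'I_d -> V) (a : 'I_d -> int)
  : V := \sum_(i < d) lam i *~ a i.

(* A set {lam_1, ..., lam_d} is represented by the family lam; independence
   forces its members to be pairwise distinct. *)
Definition zindependent (V : zmodType) (d : nat) (lam : 'I_d -> V) : Prop :=
  forall a : 'I_d -> int, zcomb lam a = 0 -> forall i, a i = 0.

Definition nice_basis (R : realType) (d : nat) (lam : 'I_d -> R[i]) : Prop :=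
  zindependent lam /\
  forall i j : 'I_d, exists a : 'I_d -> int, lam i * lam j = zcomb lam a.

Definition boxA (R : realType) (d : nat) (lam : 'I_d -> R[i]) (m : R)
  : set R[i] :=
  [set z | exists a : 'I_d -> int,
     (forall i, `|a i|%:~R <= m `^ (d%:R^-1) / 3) /\ z = zcomb lam a].

Definition is_line (R : realType) (L : set (R[i] * R[i])) : Prop :=
  exists a b e : R[i], (a, b) <> (0, 0) /\
    L = [set p | a * p.1 + b * p.2 = e].

Definition rich (R : realType) (r : nat) (P L : set (R[i] * R[i])) : Prop :=
  (`I_r #<= P `&` L)%card.

Definition rich_lines (R : realType) (r : nat) (P : set (R[i] * R[i]))
  : set (set (R[i] * R[i])) := [set L | is_line L /\ rich r P L].

(* Main.v *)
Require Import Defs.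
From mathcomp Require Import all_boot all_order all_algebra.
From mathcomp Require Import all_classical all_reals all_analysis.
From mathcomp Require Import perm complex zify ring lra.
Set Implicit Arguments.
Unset Strict Implicit.
Unset Printing Implicit Defensive.
Import Order.TTheory GRing.Theory Num.Theory.
Local Open Scope ring_scope.

(* Identify Z[Lambda] with Z^d and let d = m + 1; with s^d ~ r, f ~ n^(alpha/d) / s and
   W ~ n^((1-2alpha)/d), the lines used pass through points (x0, y0) of P in directions
   (q, p) with |q| << f and |p| << fW, so that (x0 + kq, y0 + kp), |k| < s, all lie in P.
   The issue is to find >> (W f^2)^d essentially different directions without any
   unique factorization. Fix a huge prime L and, for theta in [0, WL)^d, apply
   Dirichlet's theorem: q theta = p L + e with 0 < |q| <= h, |e| <= L / h, h ~ f.
   Since L is prime to the norms of all the q in play, theta |-> q theta is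
   a bijection modulo L, so the theta for which N(q) is too small, or for which some
   much smaller x also has x theta small modulo L, are a small proportion. For the other
   theta, e / q is O(L / h^2), so a ratio p / q arises from O((L / h^2)^d) values of theta
   only; and a line of direction (q, p) contains O(s^d) of the points (x0, y0), since two
   of them cannot have first coordinates closer than f. *)

(** * Sup-norm bounds for integer vectors, determinants and adjugates *)

Definition bnd (n : nat) (b : nat) (x : 'rV[int]_n) := [forall i, `|x 0 i| <= b%:Z].

Lemma bndP (n b : nat) (x : 'rV[int]_n) : reflect (forall i, `|x 0 i| <= b%:Z) (bnd b x).
Proof. exact: forallP. Qed.

Lemma bnd_le (n a b : nat) (x : 'rV[int]_n) : (a <= b)%N -> bnd a x -> bnd b x.
Proof. by move=> ab /bndP xa; apply/bndP => i; apply: le_trans (xa i) _. Qed.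

Lemma bndD (n a b : nat) (x y : 'rV[int]_n) : bnd a x -> bnd b y -> bnd (a + b) (x + y).
Proof.
move=> /bndP xa /bndP yb; apply/bndP => i; rewrite mxE PoszD.
exact: le_trans (ler_normD _ _) (lerD (xa i) (yb i)).
Qed.

Lemma bndN (n a : nat) (x : 'rV[int]_n) : bnd a (- x) = bnd a x.
Proof. by apply: eq_forallb => i; rewrite mxE normrN. Qed.

Lemma bndB (n a b : nat) (x y : 'rV[int]_n) : bnd a x -> bnd b y -> bnd (a + b) (x - y).
Proof. by move=> xa yb; apply: bndD => //; rewrite bndN. Qed.

Lemma bnd_mulmx (m n a b : nat) (x : 'rV[int]_m) (A : 'M[int]_(m, n)) :
  bnd a x -> (forall i j, `|A i j| <= b%:Z) -> bnd (m * (a * b)) (x *m A).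
Proof.
move=> /bndP xa Ab; apply/bndP => j; rewrite mxE.
apply: le_trans (ler_norm_sum _ _ _) _.
apply: le_trans (ler_sum _ (G := fun=> (a * b)%:Z) _) _ => [i _|].
  by rewrite normrM PoszM; apply: ler_pM; rewrite ?normr_ge0 ?xa ?Ab.
by rewrite sumr_const card_ord PoszM -mulr_natl natz.
Qed.

Lemma det_le (n b : nat) (A : 'M[int]_n) :
  (forall i j, `|A i j| <= b%:Z) -> `|\det A| <= (n`! * b ^ n)%N%:Z.
Proof.
move=> Ab; rewrite /determinant.
apply: le_trans (ler_norm_sum _ _ _) _.
apply: le_trans (ler_sum _ (G := fun=> (b ^ n)%:Z) _) _ => [s _|].
  rewrite normrM normrX normrN1 expr1n mul1r normr_prod.
  apply: le_trans (ler_prod _ (E2 := fun=> b%:Z) _) _ => [i _|].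
    by rewrite normr_ge0 Ab.
  by rewrite prodr_const card_ord -!natz -natrX.
by rewrite sumr_const PoszM card_Sn -mulr_natl natz.
Qed.

Lemma adj_le (m b : nat) (A : 'M[int]_m.+1) :
  (forall i j, `|A i j| <= b%:Z) ->
  forall i j, `|(\adj A) i j| <= (m`! * b ^ m)%N%:Z.
Proof.
move=> Ab i j; rewrite mxE /cofactor normrM normrX normrN1 expr1n mul1r.
by apply: det_le => k l; rewrite !mxE.
Qed.

(* The [z i] are the roots of the polynomial [t |-> det (A + t B)], whose leading
   coefficient [det B] is a nonzero integer. *)
Lemma det_pencil_roots (C : numClosedFieldType) (n : nat) (A B : 'M[int]_n) :
  \det B != 0 -> exists z : 'I_n -> C, forall (g : int) (t : int), 0 <= g ->
    `|\det (A + t *: B)| < g ^+ n -> exists i, `|t%:~R - z i| < g%:~R.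
Proof.
move=> dB; pose f := @intmul C 1; pose A' := map_mx intr A : 'M[C]_n.
pose B' := map_mx intr B : 'M[C]_n.
have dB' : \det B' = (\det B)%:~R by rewrite det_map_mx.
have uB : B' \in unitmx by rewrite unitmxE unitfE dB' intr_eq0.
(* With this choice [det (A + t B) = det B * p(t)]. If every root of [p] were at distance at least
   [g] from [t], the product of the [n] distances would be at least [g ^ n]. *)
pose p := char_poly (- (invmx B' *m A')).
have [r pr] := closed_field_poly_normal p.
have pmon : p \is monic by apply: char_poly_monic.
rewrite (monicP pmon) scale1r in pr.
have szr : size r = n.
  by have := size_char_poly (- (invmx B' *m A')); rewrite -/p pr size_prod_XsubC => -[].
exists (fun i => r`_i) => g t g0 dlt; apply/existsP; apply: contraLR dlt.
rewrite negb_exists -leNgt => /forallP far.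
have detE : (\det (A + t *: B))%:~R = (\det B)%:~R * p.[t%:~R].
  rewrite -det_map_mx map_mxD map_mxZ /= -/A' -/B' -dB' /p /char_poly.
  rewrite -horner_evalE -det_map_mx -det_mulmx; congr (\det _).
  rewrite /char_poly_mx map_mxB /= map_scalar_mx /= horner_evalE hornerX.
  rewrite -map_mx_comp map_mx_id; last by move=> x; rewrite /= horner_evalE hornerC.
  rewrite opprK mulmxDr mulmxA mulmxV // mul1mx mul_mx_scalar addrC.
  by [].
rewrite -(ler_int C) rmorphXn /= intr_norm detE normrM.
have gB : 1 <= `|(\det B)%:~R : C|.
  by rewrite -intr_norm ler1z -gtz0_ge1 normr_gt0.
rewrite -[X in X <= _]mul1r; apply: ler_pM => //; first by rewrite exprn_ge0 // ler0z.
rewrite pr horner_prod normr_prod (big_nth 0) szr big_mkord.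
have -> : (g%:~R : C) ^+ n = \prod_(i < n) g%:~R by rewrite prodr_const card_ord.
apply: ler_prod => i _; rewrite ler0z g0 /= hornerXsubC.
by rewrite real_leNgt ?far ?normr_real ?realz.
Qed.

(** * The order Z[Lambda] in coordinates: multiplication, norm and division *)

Section Order.
Variables (C : numClosedFieldType) (m : nat) (lam : 'I_m.+1 -> C).
Variable A : 'I_m.+1 -> 'M[int]_m.+1.

Definition phi (x : 'rV[int]_m.+1) : C := \sum_i (x 0 i)%:~R * lam i.

(** Under [lamM], the matrix of multiplication by [phi q] in the basis [lam], acting on row vectors
    from the right. *)
Definition mulmat (q : 'rV[int]_m.+1) : 'M[int]_m.+1 := \sum_i q 0 i *: A i.

Definition mulmat_bound : nat := \sum_i \sum_j \sum_k `|A i j k|%N.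

(** The norm of [phi q], as the determinant of multiplication by it on the order. *)
Definition vnorm (q : 'rV[int]_m.+1) : int := \det (mulmat q).

Lemma phiD x y : phi (x + y) = phi x + phi y.
Proof.
by rewrite /phi -big_split; apply: eq_bigr => i _; rewrite mxE rmorphD mulrDl.
Qed.

Lemma phiZ c x : phi (c *: x) = c%:~R * phi x.
Proof.
by rewrite /phi mulr_sumr; apply: eq_bigr => i _; rewrite mxE rmorphM mulrA.
Qed.

Lemma phiN x : phi (- x) = - phi x.
Proof. by rewrite -scaleN1r phiZ mulN1r. Qed.

Lemma phiB x y : phi (x - y) = phi x - phi y.
Proof. by rewrite phiD phiN. Qed.

Lemma phi0 : phi 0 = 0.
Proof. by rewrite -[0](scale0r (0 : 'rV_m.+1)) phiZ mul0r. Qed.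

Lemma phi_sum (I : finType) (F : I -> 'rV_m.+1) :
  phi (\sum_i F i) = \sum_i phi (F i).
Proof. exact: (big_morph phi phiD phi0). Qed.

Hypothesis phi_eq0 : forall x, phi x = 0 -> x = 0.
Hypothesis lamM : forall i j, lam i * lam j = phi (row j (A i)).

Lemma phi_inj : injective phi.
Proof. by move=> x y xy; apply/subr0_eq/phi_eq0; rewrite phiB xy subrr. Qed.

Lemma phiM x q : phi (x *m mulmat q) = phi x * phi q.
Proof.
rewrite mulmx_sum_row phi_sum {2}/phi mulr_suml; apply: eq_bigr => j _.
rewrite phiZ -mulrA; congr (_ * _).
have -> : row j (mulmat q) = \sum_i q 0 i *: row j (A i).
  by rewrite /mulmat linear_sum; apply: eq_bigr => i _; rewrite linearZ.
rewrite phi_sum {2}/phi mulr_sumr; apply: eq_bigr => i _.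
by rewrite phiZ -lamM; ring.
Qed.

Lemma mulmat_line q e t : mulmat (q + t *: e) = mulmat q + t *: mulmat e.
Proof.
rewrite /mulmat scaler_sumr -big_split; apply: eq_bigr => i _ /=.
by rewrite !mxE scalerDl scalerA.
Qed.

(** The order sits inside a field, so multiplication by a nonzero element has trivial kernel. *)
Lemma vnorm_neq0 q : q != 0 -> vnorm q != 0.
Proof.
apply: contraNneq => /eqP/det0P [v v0 /(congr1 phi)]; rewrite phiM phi0.
move=> /eqP; rewrite mulf_eq0 => /orP [] /eqP /phi_eq0 v00; last by rewrite v00.
by rewrite v00 eqxx in v0.
Qed.

Lemma phi_neq0 g q : (0 < g)%N -> (g ^ m.+1)%N%:Z <= `|vnorm q| -> phi q != 0.
Proof.
move=> g0; apply: contraTneq => /phi_eq0 ->; rewrite -ltNge.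
suff -> : vnorm 0 = 0 by rewrite normr0 ltz_nat expn_gt0 g0.
rewrite /vnorm (_ : mulmat 0 = 0) ?det0 //.
by rewrite /mulmat big1 // => k _; rewrite mxE scale0r.
Qed.

(** The adjugate replaces division: it multiplies by [vnorm q / phi q], so coordinates stay integral
    at the cost of the factor [vnorm q]. *)
Lemma phi_adj q v : phi (v *m \adj (mulmat q)) * phi q = (vnorm q)%:~R * phi v.
Proof. by rewrite -phiM -mulmxA mul_adj_mx mul_mx_scalar phiZ. Qed.

Lemma mulmat_le h q : bnd h q -> forall i j, `|mulmat q i j| <= (mulmat_bound * h)%N%:Z.
Proof.
move=> /bndP qh i j; rewrite /mulmat summxE.
apply: le_trans (ler_norm_sum _ _ _) _.
have -> : (mulmat_bound * h)%N%:Z = \sum_k ((\sum_i \sum_j `|A k i j|) * h)%N%:Z.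
  by rewrite /mulmat_bound big_distrl /= -natz natr_sum; apply: eq_bigr => k _; rewrite natz.
apply: ler_sum => k _; rewrite mxE normrM mulrC PoszM; apply: ler_pM => //.
rewrite -abszE lez_nat (bigD1 i) //= (bigD1 j) //= -addnA; exact: leq_addr.
Qed.

Definition mul_bound : nat := m.+1 * mulmat_bound.

Lemma bnd_mulmat a b x q : bnd a x -> bnd b q -> bnd (mul_bound * (a * b)) (x *m mulmat q).
Proof.
move=> xa qb; have := bnd_mulmx xa (mulmat_le qb); congr (is_true (bnd _ _)).
by rewrite /mul_bound; lia.
Qed.

Lemma vnorm_le h q : bnd h q -> `|vnorm q| <= ((m.+1)`! * (mulmat_bound * h) ^ m.+1)%N%:Z.
Proof. by move=> qh; apply: det_le; apply: mulmat_le. Qed.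

Lemma bnd_adj a h v q : bnd a v -> bnd h q ->
  bnd (m.+1 * (a * (m`! * (mulmat_bound * h) ^ m))) (v *m \adj (mulmat q)).
Proof. by move=> va qh; apply: bnd_mulmx va _; apply: adj_le; apply: mulmat_le. Qed.

Definition quot_bound (G : nat) : nat := m.+1 * (m`! * (mulmat_bound * G) ^ m).

Lemma bnd_adj_scaled G g a v q : bnd a v -> bnd (G * g) q ->
  bnd (quot_bound G * a * g ^ m) (v *m \adj (mulmat q)).
Proof.
move=> va qh; have := bnd_adj va qh; congr (is_true (bnd _ _)).
by rewrite /quot_bound !expnMn; ring.
Qed.

(** By the adjugate, [vnorm q *: w] has size [O(a g^m)]; dividing by [|vnorm q| >= g^(m+1)] leaves
    [O(a / g)]. A lower bound on the norm thus makes division by [q] as good as division by an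
    integer of size [g]. *)
Lemma quot_le G g a v w q : (0 < g)%N -> bnd (G * g) q -> bnd a v ->
  (g ^ m.+1)%N%:Z <= `|vnorm q| -> phi w * phi q = phi v ->
  forall i, g%:Z * `|w 0 i| <= (quot_bound G * a)%N%:Z.
Proof.
move=> g0 qh va gN wq i.
have E : vnorm q *: w = v *m \adj (mulmat q).
  apply: phi_inj; rewrite phiZ.
  have q0 := phi_neq0 g0 gN.
  by apply: (mulIf q0); rewrite phi_adj -wq mulrA.
have /bndP/(_ i) := bnd_adj_scaled va qh; rewrite -E mxE normrM => le1.
have gm : (0 < g ^ m)%N by rewrite expn_gt0 g0.
have : (g ^ m.+1)%N%:Z * `|w 0 i| <= (quot_bound G * a * g ^ m)%N%:Z.
  by apply: le_trans le1; apply: ler_wpM2r.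
by rewrite expnSr; nia.
Qed.
End Order.

(** * Finite types for the boxes [0, M)^n and [-h, h]^n, so that vectors can be counted *)

Definition ordvec n M (v : {ffun 'I_n -> 'I_M}) : 'rV[int]_n := \row_i (v i : nat)%:Z.

Definition cordvec n h (v : {ffun 'I_n -> 'I_(2 * h).+1}) : 'rV[int]_n :=
  \row_i ((v i : nat)%:Z - h%:Z).

Lemma ordvec_inj n M : injective (@ordvec n M).
Proof.
by move=> v w /rowP vw; apply/ffunP => i; apply: val_inj; have := vw i; rewrite !mxE => -[].
Qed.

Lemma bnd_ordvec n M (v : {ffun 'I_n -> 'I_M}) : bnd M (ordvec v).
Proof. by apply/bndP => i; rewrite mxE; have := ltn_ord (v i); lia. Qed.

Lemma bnd_cordvec n h (v : {ffun 'I_n -> 'I_(2 * h).+1}) : bnd h (cordvec v).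
Proof. by apply/bndP => i; rewrite mxE; have := ltn_ord (v i); lia. Qed.

Lemma cordvec_surj n h (x : 'rV[int]_n) : bnd h x ->
  exists v : {ffun 'I_n -> 'I_(2 * h).+1}, cordvec v = x.
Proof.
move=> /bndP xh; exists [ffun i : 'I_n => inord (absz (x 0 i + h%:Z)) : 'I_(2 * h).+1].
apply/rowP => i; rewrite mxE ffunE; have := xh i; rewrite ler_norml => /andP [lo hi].
by rewrite inordK; lia.
Qed.

Lemma card_le_bnd (T : finType) (S : {set T}) n U (F : T -> 'rV[int]_n) :
  {in S &, injective F} -> (forall t, t \in S -> bnd U (F t)) ->
  (#|S| <= (2 * U).+1 ^ n)%N.
Proof.
move=> Finj FU.
have /choice [c cP] (t : T) : exists v : {ffun 'I_n -> 'I_(2 * U).+1}, t \in S -> cordvec v = F t.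
  have [/FU/cordvec_surj [v vE]|_] := boolP (t \in S); first by exists v.
  by exists [ffun=> ord0].
have cinj : {in S &, injective c}.
  by move=> t u tS uS tu; apply: Finj => //; rewrite -!cP // tu.
rewrite -(card_in_imset cinj); apply: leq_trans (max_card _) _.
by rewrite card_ffun !card_ord.
Qed.

Lemma modn_close (a b n : nat) : (a %% n = b %% n)%N -> `|a%:Z - b%:Z| < n%:Z -> a = b.
Proof.
wlog le : a b / (b <= a)%N => [IH|].
  have [/IH//|/ltnW/IH{}IH ab lt] := leqP b a.
  by apply/esym/IH; rewrite // distrC.
move=> /eqP; rewrite eqn_mod_dvd // => dv lt.
by have [|gt] := posnP (a - b)%N; [lia|have := dvdn_leq gt dv; lia].
Qed.

(** * Counting in the order: small residues, Dirichlet approximation, small norms *)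

Section OrderCount.
Variables (C : numClosedFieldType) (m : nat) (lam : 'I_m.+1 -> C).
Variable A : 'I_m.+1 -> 'M[int]_m.+1.
Hypothesis phi_eq0 : forall x, phi lam x = 0 -> x = 0.
Hypothesis lamM : forall i j, lam i * lam j = phi lam (row j (A i)).
Local Notation phi := (phi lam).
Local Notation N := (vnorm A).

(** The hypothesis says [u = e / q - e' / q']. Neither quotient need lie in the order, so both are
    cleared by [N q * N q'] and bounded through the adjugates, each being [O(a / g)]. *)
Lemma diff_le G g a e e' u q q' : (0 < g)%N -> bnd (G * g) q -> bnd (G * g) q' ->
  bnd a e -> bnd a e' ->
  (g ^ m.+1)%N%:Z <= `|N q| -> (g ^ m.+1)%N%:Z <= `|N q'| ->
  phi q * phi q' * phi u = phi q' * phi e - phi q * phi e' ->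
  forall i, g%:Z * `|u 0 i| <= (2 * quot_bound A G * a)%N%:Z.
Proof.
move=> g0 qh qh' ea ea' gN gN' E i.
set b := e *m \adj (mulmat A q); set b' := e' *m \adj (mulmat A q').
have bE : phi b * phi q = (N q)%:~R * phi e by apply: phi_adj.
have bE' : phi b' * phi q' = (N q')%:~R * phi e' by apply: phi_adj.
have uE : (N q * N q') *: u = N q' *: b - N q *: b'.
  apply: (phi_inj phi_eq0); rewrite phiB !phiZ rmorphM /=.
  apply: (mulfI (phi_neq0 phi_eq0 g0 gN)); apply: (mulfI (phi_neq0 phi_eq0 g0 gN')).
  transitivity ((N q)%:~R * (N q')%:~R * (phi q * phi q' * phi u)); first by ring.
  rewrite E; transitivity ((N q')%:~R * phi q' * (phi b * phi q) -
    (N q)%:~R * phi q * (phi b' * phi q')).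
    by rewrite bE bE'; ring.
  by ring.
have /bndP/(_ i) bb := bnd_adj_scaled A ea qh.
have /bndP/(_ i) bb' := bnd_adj_scaled A ea' qh'.
rewrite -/b -/b' in bb bb'; clearbody b b'.
move/rowP/(_ i): uE; rewrite !mxE => uE.
set Z := (quot_bound A G * a * g ^ m)%N in bb bb'.
set n1 := `|N q| in gN *; set n2 := `|N q'| in gN' *.
have le1 : n1 * n2 * `|u 0 i| <= n2 * Z%:Z + n1 * Z%:Z.
  rewrite -!normrM uE; apply: le_trans (ler_normB _ _) _; rewrite !normrM.
  by apply: lerD; rewrite ler_wpM2l.
set w := `|u 0 i| in le1 *.
have w0 : 0 <= w by rewrite normr_ge0.
have gm : (0 < g ^ m.+1)%N by rewrite expn_gt0 g0.
have n10 : 0 < n1 by apply: lt_le_trans gN; rewrite ltz_nat.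
have n20 : 0 < n2 by apply: lt_le_trans gN'; rewrite ltz_nat.
(* After multiplication by [g ^ m.+1], this factor is bounded by [n1] in one summand and by [n2] in
   the other, and [n1 * n2] cancels. *)
have le2 : (g ^ m.+1)%N%:Z * w <= 2 * Z%:Z.
  rewrite -(ler_pM2l n10) -(ler_pM2l n20).
  have : (g ^ m.+1)%N%:Z * (n1 * n2 * w) <= (g ^ m.+1)%N%:Z * (n2 * Z%:Z + n1 * Z%:Z).
    by apply: ler_wpM2l.
  have : n2 * Z%:Z * (g ^ m.+1)%N%:Z <= n2 * Z%:Z * n1
   
    by apply: ler_wpM2l; rewrite ?mulr_ge0 // ltW.
  have : n1 * Z%:Z * (g ^ m.+1)%N%:Z <= n1 * Z%:Z * n2
   
    by apply: ler_wpM2l; rewrite ?mulr_ge0 // ltW.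
  lia.
have gm' : (0 < g ^ m)%N by rewrite expn_gt0 g0.
move: le2; rewrite /Z expnSr; nia.
Qed.

(* The vectors of [0, WL)^d some product of which with the family [qf] lies
   within [E] of [L Z^d]. *)
Definition small_residue (T : finType) (Q : {set T}) (qf : T -> 'rV[int]_m.+1) (L W E : nat) :
    {set {ffun 'I_m.+1 -> 'I_(W * L)}} :=
  [set v | `[< exists t, t \in Q /\ exists y e,
        bnd E e /\ phi (ordvec v) * phi (qf t) = phi (L%:Z *: y + e) >] ]%SET.

(** A vector is determined by its multiplier, its coordinatewise quotients by [L] and the residue
    [e]: if [v] and [w] share these, their difference times [q] vanishes modulo [L], hence so does
    [N q] times it by the adjugate, and [N q] is invertible modulo [L]. *)
Lemma card_small_residue (T : finType) (Q : {set T}) (qf : T -> 'rV[int]_m.+1) (L W E : nat) :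
  (0 < L)%N -> (forall t, t \in Q -> coprime L `|N (qf t)|) ->
  (#|small_residue Q qf L W E| <= #|Q| * (W ^ m.+1 * (2 * E).+1 ^ m.+1))%N.
Proof.
move=> L0 cop; set S := small_residue Q qf L W E.
(* A member [v0] of [S] provides the default value of the choice function outside [S]. *)
have [->|[v0 v0S]] := set_0Vmem S; first by rewrite cards0.
pose P (v : {ffun 'I_m.+1 -> 'I_(W * L)})
    (p : T * {ffun 'I_m.+1 -> 'I_W} * {ffun 'I_m.+1 -> 'I_(2 * E).+1}) :=
  [/\ p.1.1 \in Q, forall i, (v i %/ L)%N = p.1.2 i
    & exists y, phi (ordvec v) * phi (qf p.1.1) = phi (L%:Z *: y + cordvec p.2)].
have witness0 (v : {ffun 'I_m.+1 -> 'I_(W * L)}) : v \in S -> exists p, P v p.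
  rewrite inE => /asboolP [t [tQ [y [e [eE ve]]]]].
  have lt i : (v i %/ L < W)%N by rewrite ltn_divLR.
  have [e' e'E] := cordvec_surj eE.
  exists (t, [ffun i => Ordinal (lt i)], e'); split => //=.
    by move=> i; rewrite ffunE.
  by exists y; rewrite e'E.
have witness (v : {ffun 'I_m.+1 -> 'I_(W * L)}) : exists p, v \in S -> P v p.
  have [/witness0 [p vp]|_] := boolP (v \in S); first by exists p.
  by have [p _] := witness0 _ v0S; exists p.
have [F FP] := choice witness.
have Finj : {in S &, injective F}.
  move=> v w vS wS vw.
  have [_ dv [y yE]] := FP _ vS; have [_ dw [z zE]] := FP _ wS.
  have tQ := (FP _ vS).
  rewrite -vw in dw zE.
  set t := (F v).1.1 in yE zE.
  have {}tQ : t \in Q by case: tQ.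
  have D : N (qf t) *: (ordvec v - ordvec w) = L%:Z *: ((y - z) *m \adj (mulmat A (qf t))).
    have -> : N (qf t) *: (ordvec v - ordvec w) =
        (ordvec v - ordvec w) *m mulmat A (qf t) *m \adj (mulmat A (qf t)).
      by rewrite -mulmxA mul_mx_adj mul_mx_scalar.
    rewrite scalemxAl; congr (_ *m _); apply: (phi_inj phi_eq0).
    rewrite (phiM lamM) phiB mulrBl yE zE phiZ phiB !phiD !phiZ; ring.
  apply/ffunP => i; apply: val_inj => /=.
  move/rowP/(_ i): D; rewrite !mxE => D.
  have : (L %| `|N (qf t)| * `|(v i)%:Z - (w i)%:Z|)%N.
    by rewrite -abszM D abszM; apply: dvdn_mulr.
  rewrite Gauss_dvdr ?cop // => Ld.
  have dvw : (v i %/ L = w i %/ L)%N by rewrite dv dw.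
  change (nat_of_ord (v i) = w i); apply/eqP.
  rewrite (divn_eq (v i) L) (divn_eq (w i) L) dvw eqn_add2l.
  have [le|/ltnW le] := leqP (w i) (v i).
    rewrite eqn_mod_dvd //; move: Ld; congr (is_true (_ %| _)%N); lia.
  rewrite eq_sym eqn_mod_dvd //; move: Ld; congr (is_true (_ %| _)%N); lia.
rewrite -(card_in_imset Finj).
apply: (@leq_trans #|finset.setX (finset.setX Q [set: _]%SET) [set: _]%SET|).
  apply/subset_leq_card/fintype.subsetP => _ /imsetP [v vS ->].
  by rewrite !inE; have [] := FP _ vS => ->.
by rewrite !cardsX !cardsT !card_ffun !card_ord mulnA.
Qed.

(* Dirichlet's approximation theorem, by the pigeonhole principle. *)
Lemma dirichlet L h theta : (0 < L)%N -> (0 < h)%N ->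
  exists q y e, [/\ q != 0, bnd h q, bnd (L %/ h) e &
    phi theta * phi q = phi (L%:Z *: y + e)].
Proof.
(* Since [S * h > L], cells of side [S] cut [0, L) into at most [h] pieces per coordinate, fewer
   than the [h + 1] values of a coordinate of [v]. Two residues in one cell differ by at most
   [S - 1 = L %/ h]. *)
move=> L0 h0; set S := (L %/ h).+1.
pose x (v : {ffun 'I_m.+1 -> 'I_h.+1}) i := (ordvec v *m mulmat A theta) 0 i.
pose r v i := absz (x v i %% L)%Z.
have rE v i : (r v i)%:Z = (x v i %% L)%Z.
  by rewrite /r gez0_abs // modz_ge0 //; lia.
have rL v i : (r v i < L)%N.
  by rewrite -ltz_nat rE ltz_pmod //; lia.
have cell v i : (r v i %/ S < h)%N.
  rewrite ltn_divLR // /S mulnS mulnC; apply: leq_trans (rL v i) _.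
  have := divn_eq L h; have := ltn_pmod L h0; lia.
pose F v := [ffun i => Ordinal (cell v i)].
have : ~~ injectiveb F.
  apply/negP => /injectiveP /leq_card; rewrite !card_ffun !card_ord.
  by rewrite leq_exp2r // ltnn.
case/injectivePn => v0 [w0 vw0 FE0].
have [v [w [vw FE]]] : exists v w : {ffun 'I_m.+1 -> 'I_h.+1}, v != w /\ F v = F w.
  by exists v0, w0.
exists (ordvec v - ordvec w).
exists (\row_i ((x v i %/ L)%Z - (x w i %/ L)%Z)).
exists (\row_i ((r v i)%:Z - (r w i)%:Z)); split.
- by rewrite subr_eq0; apply: contra_neq vw => /ordvec_inj.
- apply/bndP => i; rewrite !mxE ler_norml; have := ltn_ord (v i); have := ltn_ord (w i); lia.
- apply/bndP => i; rewrite mxE.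
  move/ffunP/(_ i): FE; rewrite !ffunE => -[] cE.
  have := divn_eq (r v i) S; have := divn_eq (r w i) S; rewrite cE.
  have := @ltn_pmod (r v i) S isT; have := @ltn_pmod (r w i) S isT.
  move: (r w i %/ S * S)%N (r v i %% S)%N (r w i %% S)%N => k a b.
  by rewrite /S ler_norml; lia.
rewrite mulrC -(phiM lamM); congr phi; rewrite mulmxBl; apply/rowP => i.
move: (divz_eq (x v i) L) (divz_eq (x w i) L).
rewrite -!rE => Ev Ew.
transitivity (x v i - x w i); first by rewrite /x [LHS]mxE [X in _ + X]mxE.
by rewrite {1}Ev {1}Ew !mxE; ring.
Qed.

(* On each line in a fixed direction [e], the norm is a polynomial of degree
   [m.+1] with leading coefficient at least 1 in absolute value. *)
Lemma card_small_vnorm h g : (0 < g)%N ->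
  (#|[set v : {ffun 'I_m.+1 -> 'I_(2 * h).+1} | (`|N (cordvec v)| < (g ^ m.+1)%N%:Z)%R]%SET|
   <= (2 * h).+1 ^ m * (m.+1 * (2 * g)))%N.
Proof.
move=> g0; set S := [set v | _]%SET.
pose e : 'rV[int]_m.+1 := delta_mx 0 0.
have e0 : e != 0 by apply/eqP => /rowP/(_ 0); rewrite !mxE !eqxx.
have Ne : \det (mulmat A e) != 0 by apply: (vnorm_neq0 phi_eq0 lamM).
(* The base point of the line through [cordvec v] in direction [e]; it does not depend on the
   coordinate [v ord0]. *)
pose B (v : {ffun 'I_m.+1 -> 'I_(2 * h).+1}) : 'rV[int]_m.+1 := cordvec v - (v ord0 : nat)%:Z *: e.
have BE (v w : {ffun 'I_m.+1 -> 'I_(2 * h).+1}) :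
    [ffun i => v (lift ord0 i)] = [ffun i => w (lift ord0 i)] -> B v = B w.
  move=> /ffunP vw; apply/rowP => i; rewrite !mxE eqxx /=.
  case: (unliftP ord0 i) => [j ->|->]; last by rewrite eqxx !mulr1 ![_ - h%:Z]addrC !addrK.
  have := vw j; rewrite !ffunE => ->.
  by rewrite [lift _ _ == _]eq_sym (negbTE (neq_lift ord0 j)) !mulr0.
have roots (b : 'rV[int]_m.+1) : exists z : 'I_m.+1 -> C, forall t : int,
    `|\det (mulmat A b + t *: mulmat A e)| < (g ^ m.+1)%N%:Z ->
    exists i, `|t%:~R - z i| < g%:R.
  have [z zP] := det_pencil_roots C (mulmat A b) Ne.
  exists z => t tg; apply: (zP g%:Z) => //.
  by rewrite -natz -natrX natz.
have [z zP] := choice roots.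
have index (v : {ffun 'I_m.+1 -> 'I_(2 * h).+1}) :
    exists i, v \in S -> `|((v ord0)%:Z)%:~R - z (B v) i| < (g%:R : C).
  have [|_] := boolP (v \in S); last by exists ord0.
  rewrite inE => vg; have [|i iP] := zP (B v) (v ord0)%:Z; last by exists i.
  by rewrite -mulmat_line subrK.
have [I IP] := choice index.
have g2 : (0 < 2 * g)%N by rewrite muln_gt0.
(* Two first coordinates within [g] of the same root differ by less than [2 * g], so their residue
   modulo [2 * g] separates them. *)
pose F (v : {ffun 'I_m.+1 -> 'I_(2 * h).+1}) :=
  ([ffun i => v (lift ord0 i)] : {ffun 'I_m -> 'I_(2 * h).+1},
   (I v, Ordinal (ltn_pmod (v ord0) g2))).
have Finj : {in S &, injective F}.
  move=> v w vS wS [vw Ivw tvw].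
  have Bvw := BE _ _ vw.
  have := IP _ wS; have := IP _ vS; rewrite Bvw -Ivw => lt1 lt2.
  have : `|((v ord0)%:Z)%:~R - ((w ord0)%:Z)%:~R| < ((2 * g)%N%:Z)%:~R :> C.
    apply: le_lt_trans (ler_distD (z (B w) (I v)) _ _) _.
    rewrite PoszM rmorphM mulr_natl mulr2n; apply: ltrD => //.
    by rewrite distrC.
  rewrite -rmorphB /= -intr_norm ltr_int => lt.
  have v0w0 : v ord0 = w ord0.
    by apply: ord_inj; apply: modn_close tvw lt.
  apply/ffunP => i; case: (unliftP ord0 i) => [j ->|-> //].
  by move/ffunP/(_ j): vw; rewrite !ffunE.
rewrite -(card_in_imset Finj); apply: leq_trans (max_card _) _.
by rewrite !card_prod card_ffun !card_ord.
Qed.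
End OrderCount.

(** * Numerical bounds for the proportion of exceptional theta *)

Lemma leq_exp2r_imp a b n : (a <= b)%N -> (a ^ n <= b ^ n)%N.
Proof. by case: n => // n; rewrite leq_exp2r. Qed.

(** Each [(2 * z).+1] is at most [3 * z]. Multiplying by [h] completes the powers to
    [(h * E) ^ m.+1], and the remaining constant times [g] is absorbed by the factor [h]. *)
Lemma small_norm_count_le m g h E L : h = (8 * m.+1 * 9 ^ m.+1 * g)%N ->
  (0 < g)%N -> (0 < E)%N -> (h * E <= L)%N ->
  (4 * ((2 * h).+1 ^ m * (m.+1 * (2 * g)) * (2 * E).+1 ^ m.+1) <= L ^ m.+1)%N.
Proof.
move=> hE g0 E0 hL.
have h0 : (0 < h)%N by rewrite hE !muln_gt0 expn_gt0 g0.
rewrite -(leq_pmul2l h0).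
apply: (@leq_trans (h * (4 * ((3 * h) ^ m * (m.+1 * (2 * g)) * (3 * E) ^ m.+1)))).
  rewrite leq_pmul2l // leq_pmul2l //; apply: leq_mul; last by apply: leq_exp2r_imp; lia.
  by rewrite leq_mul2r leq_exp2r_imp ?orbT //; lia.
have -> : (h * (4 * ((3 * h) ^ m * (m.+1 * (2 * g)) * (3 * E) ^ m.+1)) =
    8 * m.+1 * (3 ^ m * 3 ^ m.+1) * g * (h * E) ^ m.+1)%N.
  by rewrite !expnMn !expnS; ring.
apply: leq_mul; last by rewrite leq_exp2r.
rewrite {1}hE leq_mul2r leq_mul2l -[9%N]/(3 * 3)%N expnMn leq_mul2r leq_exp2l //.
by rewrite leqnSn !orbT.
Qed.

(** The constant 36 is [4 * 3 * 3]: two factors 3 from [(2 * z).+1 <= 3 * z], and [4 <= 4 ^ d]. *)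
Lemma small_vector_count_le d c f h E L : (0 < d)%N -> (0 < f)%N -> (0 < c)%N -> (0 < E)%N ->
  (36 * c * f <= h)%N -> (h * E <= L)%N ->
  (4 * ((2 * f).+1 ^ d * (2 * (c * E)).+1 ^ d) <= L ^ d)%N.
Proof.
move=> d0 f0 c0 E0 fh hL.
have cE0 : (0 < c * E)%N by rewrite muln_gt0 c0.
apply: (@leq_trans ((4 * ((3 * f) * (3 * (c * E)))) ^ d)).
  rewrite expnMn; apply: leq_mul; first by rewrite -{1}(expn1 4) leq_exp2l.
  by rewrite expnMn leq_mul // leq_exp2r //; lia.
rewrite leq_exp2r //; apply: leq_trans hL; apply: leq_trans (leq_mul fh (leqnn E)).
by rewrite (_ : (4 * _ = 36 * c * f * E)%N) //; ring.
Qed.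

(** * Many directions with few repetitions *)

Section OrderDirections.
Variables (C : numClosedFieldType) (m : nat) (lam : 'I_m.+1 -> C).
Variable A : 'I_m.+1 -> 'M[int]_m.+1.
Hypothesis phi_eq0 : forall x, phi lam x = 0 -> x = 0.
Hypothesis lamM : forall i j, lam i * lam j = phi lam (row j (A i)).
Local Notation phi := (phi lam).
Local Notation N := (vnorm A).

Definition parallel (x y x' y' : 'rV[int]_m.+1) : bool := phi x * phi y' == phi x' * phi y.

(* The directions (q, p) have |q| <= h = dirh f and |N q| >= g^d with g = dirF f,
   and no multiple (x, y) of (q, p) has 0 < |x| <= f. The factor dirG = h / g makes
   vectors of small norm rare in the box of radius h, and dirF makes the points
   of [0, WL)^d having a multiplier of size at most f rare. *)
Definition dirG : nat := 8 * m.+1 * 9 ^ m.+1.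
Definition dirQ : nat := quot_bound A dirG.
Definition dirF : nat := 36 * (dirQ * mul_bound A).+1.
Definition dirh (f : nat) : nat := dirG * (dirF * f).

(** Directions are indexed by the points theta of [0, WL)^d outside two exceptional sets, each at
    most a quarter of the box. Distinct theta may share a slope; the last clause bounds this
    multiplicity by [O((L / h^2)^d)]. *)
Lemma exists_directions f W : (0 < f)%N -> (0 < W)%N ->
  exists (T : finType) (D : {set T}) (q p : T -> 'rV[int]_m.+1) (L : nat),
  [/\ (0 < L)%N, ((W * L) ^ m.+1 <= 2 * #|D|)%N,
    forall t, t \in D -> [/\ q t != 0, bnd (dirh f) (q t),
      bnd ((mul_bound A).+1 * (dirh f * W)) (p t) &
      forall x y, bnd f x -> phi x * phi (p t) = phi y * phi (q t) -> x = 0] &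
    forall t0, t0 \in D ->
      (#|[set t in D | parallel (q t0) (p t0) (q t) (p t)]%SET|
        * ((dirF * f) * dirh f) ^ m.+1 <= ((4 * dirQ).+1 * L) ^ m.+1)%N].
Proof.
move=> f0 W0; set g := (dirF * f)%N; set h := dirh f.
have g0 : (0 < g)%N by rewrite muln_gt0 f0.
have h0 : (0 < h)%N by rewrite /h /dirh !muln_gt0 expn_gt0 f0.
have fg : (f <= g)%N by rewrite leq_pmull.
have fh : (f <= h)%N by apply: leq_trans fg _; rewrite leq_pmull // muln_gt0 expn_gt0.
(* A prime beyond all norms from the box of radius [h] is coprime to every nonzero one of them;
   [L > g * h] makes [E = L %/ h] positive. *)
have [L Lbig Lpr] := prime_above (maxn ((m.+1)`! * (mulmat_bound A * h) ^ m.+1) (g * h)).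
move: Lbig; rewrite gtn_max => /andP [LN Lgh].
have L0 : (0 < L)%N by apply: prime_gt0.
set E := (L %/ h)%N.
have gE : (g <= E)%N by rewrite leq_divRL // ltnW.
have E0 : (0 < E)%N by apply: leq_trans gE.
have hE : (h * E <= L)%N by rewrite mulnC leq_trunc_div.
have EL : (E <= L)%N by rewrite leq_div.
have cop x : x != 0 -> bnd h x -> coprime L `|N x|.
  move=> x0 xh; rewrite prime_coprime //; apply/negP => /dvdn_leq.
  rewrite absz_gt0 (vnorm_neq0 phi_eq0 lamM) // => /(_ isT).
  by rewrite leqNgt -ltz_nat abszE => /negP; apply; apply: le_lt_trans (vnorm_le A xh) _.
pose T := {ffun 'I_m.+1 -> 'I_(W * L)}.
pose Q1 := [set v : {ffun 'I_m.+1 -> 'I_(2 * h).+1} |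
  (cordvec v != 0) && (`|N (cordvec v)| < (g ^ m.+1)%N%:Z)%R]%SET.
pose Q2 := [set v : {ffun 'I_m.+1 -> 'I_(2 * f).+1} | cordvec v != 0]%SET.
pose c := (dirQ * mul_bound A).+1.
pose Bad1 := small_residue lam Q1 (@cordvec m.+1 h) L W E.
pose Bad2 := small_residue lam Q2 (@cordvec m.+1 f) L W (c * E).
have card1 : (4 * #|Bad1| <= (W * L) ^ m.+1)%N.
  have le1 : (#|Bad1| <= #|Q1| * (W ^ m.+1 * (2 * E).+1 ^ m.+1))%N.
    apply: (card_small_residue phi_eq0 lamM) => // t; rewrite inE => /andP [t0 _].
    exact: cop (bnd_cordvec _).
  have le2 : (#|Q1| <= (2 * h).+1 ^ m * (m.+1 * (2 * g)))%N.
    apply: leq_trans (card_small_vnorm phi_eq0 lamM h g0).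
    by apply/subset_leq_card/fintype.subsetP => v; rewrite !inE => /andP [].
  have := @small_norm_count_le m g h E L erefl g0 E0 hE.
  rewrite expnMn => le3; apply: leq_trans (leq_mul (leqnn (W ^ m.+1)) le3).
  apply: leq_trans (leq_mul (leqnn 4) le1) _.
  apply: leq_trans (leq_mul (leqnn 4) (leq_mul le2 (leqnn _))) _.
  by apply: eq_leq; ring.
have card2 : (4 * #|Bad2| <= (W * L) ^ m.+1)%N.
  have le1 : (#|Bad2| <= #|Q2| * (W ^ m.+1 * (2 * (c * E)).+1 ^ m.+1))%N.
    apply: (card_small_residue phi_eq0 lamM) => // t; rewrite inE => t0.
    exact: cop (bnd_le fh (bnd_cordvec _)).
  have le2 : (#|Q2| <= (2 * f).+1 ^ m.+1)%N.
    by apply: leq_trans (max_card _) _; rewrite card_ffun !card_ord.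
  have le3 : (4 * ((2 * f).+1 ^ m.+1 * (2 * (c * E)).+1 ^ m.+1) <= L ^ m.+1)%N.
    apply: (@small_vector_count_le _ c f h) => //.
    by rewrite /h /dirh /dirF -/c leq_pmull // !muln_gt0 expn_gt0.
  rewrite expnMn; apply: leq_trans (leq_mul (leqnn (W ^ m.+1)) le3).
  apply: leq_trans (leq_mul (leqnn 4) le1) _.
  apply: leq_trans (leq_mul (leqnn 4) (leq_mul le2 (leqnn _))) _.
  by apply: eq_leq; ring.
have cardT : #|T| = ((W * L) ^ m.+1)%N by rewrite card_ffun !card_ord.
have /choice [q /choice [p /choice [e qpe]]] (t : T) := dirichlet lamM (ordvec t) L0 h0.
pose D := ~: (Bad1 :|: Bad2) : {set T}.
(* A multiplier [q t] of small norm would itself witness that [t] lies in [Bad1]. *)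
have qN t : t \in D -> (g ^ m.+1)%N%:Z <= `|N (q t)|.
  have [q0 qh eE tE] := qpe t.
  rewrite inE; apply: contraR; rewrite -ltNge => lt.
  have [v vE] := cordvec_surj qh.
  rewrite inE inE; apply/orP; left; apply/asboolP; exists v.
  by rewrite inE vE q0 lt; split => //; exists (p t), (e t).
exists T, D, q, p, L; split => //.
- have := cardsC (Bad1 :|: Bad2); rewrite -/D cardT => /esym.
  have : (#|Bad1 :|: Bad2| <= #|Bad1| + #|Bad2|)%N by rewrite cardsU leq_subr.
  by move: #|D| #|Bad1| #|Bad2| #|_ :|: _| ((W * L) ^ m.+1)%N card1 card2; lia.
- move=> t tD; have [q0 qh eE tE] := qpe t; split => //.
    have Lp : L%:Z *: p t = q t *m mulmat A (ordvec t) - e t.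
      apply: (phi_inj phi_eq0); rewrite phiB (phiM lamM) mulrC tE phiD; ring.
    have := bndB (bnd_mulmat A qh (bnd_ordvec t)) eE.
    rewrite -Lp => /bndP Lpb; apply/bndP => i; have := Lpb i.
    rewrite mxE normrM => le; rewrite -(ler_pM2l (_ : 0 < L%:Z)) //.
    apply: le_trans le _.
    rewrite -PoszM lez_nat.
    apply: (@leq_trans (mul_bound A * (h * (W * L)) + L * (h * W))).
      by rewrite leq_add2l; apply: leq_trans EL _; rewrite leq_pmulr // muln_gt0 h0.
    by apply: eq_leq; rewrite -/h; ring.
  have tN := qN t tD.
  move=> x y xf xy; apply: contraTeq tD => x0; rewrite !inE negbK; apply/orP; right.
  apply/asboolP; have [v vE] := cordvec_surj xf; exists v; rewrite inE vE; split => //.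
  (* From [x p = y q] follows [x theta - L y = x e / q], which [quot_le] bounds by [c * E]; a
     nonzero [x] therefore puts theta in [Bad2]. *)
  pose e2 := x *m mulmat A (ordvec t) - L%:Z *: y.
  have e2E : phi e2 * phi (q t) = phi (x *m mulmat A (e t)).
    rewrite phiB !(phiM lamM) phiZ.
    transitivity (phi x * (phi (ordvec t) * phi (q t)) - L%:~R * (phi y * phi (q t))).
      by ring.
    by rewrite tE phiD phiZ -xy; ring.
  exists y, e2; split; last by rewrite /e2 phiD phiB (phiM lamM); ring.
  have e2b := quot_le phi_eq0 lamM g0 qh (bnd_mulmat A xf eE) tN e2E.
  apply/bndP => i; have := e2b i; rewrite -/dirQ => e2i.
  rewrite -(ler_pM2l (_ : 0 < f%:Z)) //.
  apply: (@le_trans _ _ (g%:Z * `|e2 0 i|)); first by rewrite ler_wpM2r.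
  apply: le_trans e2i _; rewrite -PoszM lez_nat /c.
  rewrite (_ : (dirQ * _ = f * (dirQ * mul_bound A * E))%N); last by ring.
  by rewrite leq_mul2l leq_mul2r leqnSn !orbT.
move=> t0 t0D; have [_ q0h e0E t0E] := qpe t0.
(* For equal slopes the terms [L p / q] cancel in [theta - theta0], leaving [e / q - e0 / q0], of
   size at most [U] by [diff_le]. *)
set S := [set t in D | _]%SET; set U := (2 * dirQ * E %/ g)%N.
have cardS : (#|S| <= (2 * U).+1 ^ m.+1)%N.
  apply: (@card_le_bnd _ _ _ U (fun t => ordvec t - ordvec t0)).
    by move=> t u _ _ /addIr /ordvec_inj.
  move=> t; rewrite inE => /andP [tD /eqP par]; have [_ qh eE tE] := qpe t.
  apply/bndP => i.
  have uE : phi (q t) * phi (q t0) * phi (ordvec t - ordvec t0) =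
      phi (q t0) * phi (e t) - phi (q t) * phi (e t0).
    rewrite phiB.
    transitivity (phi (q t0) * (phi (ordvec t) * phi (q t)) -
      phi (q t) * (phi (ordvec t0) * phi (q t0))); first by ring.
    rewrite tE t0E !phiD !phiZ.
    transitivity (L%:~R * (phi (q t0) * phi (p t) - phi (q t) * phi (p t0)) +
      phi (q t0) * phi (e t) - phi (q t) * phi (e t0)); first by ring.
    by rewrite par subrr mulr0 add0r.
  have := diff_le phi_eq0 lamM g0 qh q0h eE e0E (qN t tD) (qN t0 t0D) uE i.
  by rewrite -abszE -PoszM !lez_nat -/dirQ leq_divRL // mulnC.
apply: leq_trans (leq_mul cardS (leqnn _)) _; rewrite -expnMn leq_exp2r // -/h.
apply: (@leq_trans ((4 * dirQ).+1 * (h * E))); last by rewrite leq_mul2l hE orbT.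
have Ug : (U * g <= 2 * dirQ * E)%N by rewrite leq_trunc_div.
rewrite (_ : (_.+1 * (g * h) = h * ((2 * U).+1 * g))%N); last by ring.
rewrite [leqRHS]mulnCA leq_mul2l; apply/orP; right.
rewrite [leqLHS]mulSn [leqRHS]mulSn -!mulnA; apply: leq_add => //.
apply: (@leq_trans (2 * (2 * dirQ * E))); first by rewrite leq_mul2l.
by rewrite !mulnA.
Qed.
End OrderDirections.

(** * Counting distinct values by fibres *)

Lemma size_sum_undup (U : eqType) (s : seq U) :
  size s = (\sum_(x <- undup s) count_mem x s)%N.
Proof.
rewrite -(perm_size (perm_count_undup s)) size_flatten /shape -map_comp sumnE big_map.
by apply: eq_bigr => x _; rewrite /= size_nseq.
Qed.

(** The fibre bound is [Y / X], kept multiplied out to remain in the natural numbers. *)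
Lemma card_le_fibres (T : finType) (U : eqType) (S : {set T}) (key : T -> U) X Y :
  (forall c0, c0 \in S -> (#|[set c in S | key c == key c0]%SET| * X <= Y)%N) ->
  (#|S| * X <= size (undup [seq key c | c <- enum S]) * Y)%N.
Proof.
move=> fib; set s := [seq key c | c <- enum S].
have -> : #|S| = size s by rewrite size_map -cardE.
rewrite size_sum_undup big_distrl /=.
apply: (@leq_trans (\sum_(x <- undup s) Y)).
  rewrite big_seq [leqRHS]big_seq; apply: leq_sum => u.
  rewrite mem_undup => /mapP [c0]; rewrite mem_enum => c0S ->.
  apply: leq_trans (fib _ c0S); rewrite leq_mul2r; apply/orP; right.
  rewrite count_map cardE -size_filter; apply: uniq_leq_size.
    exact/filter_uniq/enum_uniq.
  by move=> c; rewrite mem_filter !mem_enum !inE andbC.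
by rewrite big_const_seq count_predT iter_addn_0 mulnC.
Qed.

(** * Rich lines from directions and base points *)

Section OrderLines.
Variables (R : realType) (m : nat) (lam : 'I_m.+1 -> R[i]).
Variable A : 'I_m.+1 -> 'M[int]_m.+1.
Hypothesis phi_eq0 : forall x, phi lam x = 0 -> x = 0.
Hypothesis lamM : forall i j, lam i * lam j = phi lam (row j (A i)).
Local Notation phi := (phi lam).

(** The pair is (slope, intercept); the coefficient 1 is kept so that the equation has the shape
    required by [is_line]. *)
Definition slope_line (u : R[i] * R[i]) : set (R[i] * R[i]) :=
  [set z | - u.1 * z.1 + 1 * z.2 = u.2]%classic.

Lemma slope_line_inj : injective slope_line.
Proof.
move=> [a b] [a' b'] E.
have on : slope_line (a', b') (0, b) by rewrite -E /slope_line /=; ring.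
have on1 : slope_line (a', b') (1, a + b) by rewrite -E /slope_line /=; ring.
move: on on1; rewrite /slope_line /= => e0 e1.
have bb : b = b' by rewrite -e0; ring.
have aa : a = a' by apply: (addIr b'); rewrite -[in RHS]e1 -bb; ring.
by rewrite aa bb.
Qed.

(** The triples (direction, x0, y0) are counted and divided by the largest number of triples giving
    one line. The points on it are the base point plus [k (q, p)], with [k] in the order and
    coordinates in [0, s), hence [s ^ m.+1] points. *)
Lemma exists_rich_lines : exists Dc : nat, (0 < Dc)%N /\
  forall s f W : nat, (0 < s)%N -> (0 < f)%N -> (0 < W)%N ->
  exists us : seq (R[i] * R[i]),
  [/\ uniq us, ((s * f ^ 4 * W ^ 2) ^ m.+1 <= Dc * size us)%N &
    forall u, u \in us -> exists pt : {ffun 'I_m.+1 -> 'I_s} -> R[i] * R[i],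
      injective pt /\ forall v, slope_line u (pt v) /\
        exists x y, [/\ pt v = (phi x, phi y), bnd (Dc * (s * f)) x & bnd (Dc * (s * f * W)) y]].
Proof.
have [G [G0 hE]] : exists G, (0 < G)%N /\ forall f, dirh A f = (G * f)%N.
  by exists (dirG m * dirF A)%N; split=> [|f]; rewrite ?muln_gt0 ?expn_gt0 // /dirh mulnA.
have [K [K0 KE]] : exists K, (0 < K)%N /\ K = (mul_bound A).+1 by exists (mul_bound A).+1.
have bK : (mul_bound A <= K)%N by rewrite KE.
exists (2 * (4 * dirQ A).+1 ^ m.+1 + 2 * (K * K * G))%N; split.
  by rewrite addn_gt0 muln_gt0 expn_gt0.
set Dc := (_ + _)%N => s f W s0 f0 W0.
have [T [D [q [p [L [L0 cardD dirP classP]]]]]] := exists_directions phi_eq0 lamM f0 W0.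
rewrite -KE hE in dirP classP.
(* The boxes for the base points match the sizes of the displacements [k q] and [k p]; [M1] is a
   multiple of [f], so its box splits into [M ^ m.+1] cells of side [f]. *)
pose M := (K * G * s)%N; pose M1 := (M * f)%N; pose M2 := (K * K * (s * (G * f * W)))%N.
pose S : {set T * {ffun 'I_m.+1 -> 'I_M1} * {ffun 'I_m.+1 -> 'I_M2}} :=
  finset.setX (finset.setX D [set: _]%SET) [set: _]%SET.
pose key (c : T * {ffun 'I_m.+1 -> 'I_M1} * {ffun 'I_m.+1 -> 'I_M2}) :=
  (phi (p c.1.1) / phi (q c.1.1),
   phi (ordvec c.2) - phi (p c.1.1) / phi (q c.1.1) * phi (ordvec c.1.2)).
have qn0 t : t \in D -> phi (q t) != 0.
  by move=> /dirP [q0 _ _ _]; apply: contra_neq q0; apply: phi_eq0.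
have fib c0 : c0 \in S ->
    (#|[set c in S | key c == key c0]%SET| * ((dirF A * f) * (G * f)) ^ m.+1
      <= ((4 * dirQ A).+1 * L * M) ^ m.+1)%N.
  rewrite !inE /= !andbT => t0D; have := classP _ t0D.
  set cl := [set t in D | _]%SET => clP.
  have cellP (c : T * {ffun 'I_m.+1 -> 'I_M1} * {ffun 'I_m.+1 -> 'I_M2}) i :
    (c.1.2 i %/ f < M)%N by rewrite ltn_divLR.
  pose F c : T * {ffun 'I_m.+1 -> 'I_M} := (c.1.1, [ffun i => Ordinal (cellP c i)]).
  set fb := [set c in S | key c == key c0]%SET.
  (* Two base points of one line with [x]-parts in the same cell differ by a multiple of the
     direction whose first part is at most [f], which [dirP] forces to vanish. *)
  have Finj : {in fb &, injective F}.
    move=> [[t x] y] [[t' x'] y']; rewrite !inE /= !andbT => /andP [tD /eqP kc].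
    move=> /andP [tD' /eqP kc'].
    move=> [tt' xx']; subst t'.
    have kk : key (t, x, y) = key (t, x', y') by rewrite kc kc'.
    case: kk => kk.
    have [_ _ _ free] := dirP _ tD; have qt := qn0 _ tD.
    have x0 : ordvec x - ordvec x' = 0.
      apply: (free _ (ordvec y - ordvec y')).
        apply/bndP => i; rewrite !mxE; move/ffunP/(_ i): xx'; rewrite !ffunE => -[] e.
        have := divn_eq (x i) f; have := divn_eq (x' i) f; rewrite -e.
        have := ltn_pmod (x i) f0; have := ltn_pmod (x' i) f0.
        move: (x i %/ f * f)%N (x i %% f)%N (x' i %% f)%N => k a b.
        by rewrite ler_norml; lia.
      apply: (mulIf (invr_neq0 qt)); rewrite mulfK // !phiB.
      transitivity (phi (p t) / phi (q t) * phi (ordvec x) -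
        phi (p t) / phi (q t) * phi (ordvec x')); first by ring.
      transitivity (phi (ordvec y) - (phi (ordvec y) - phi (p t) / phi (q t) * phi (ordvec x))
        - phi (p t) / phi (q t) * phi (ordvec x')); first by ring.
      by rewrite kk; ring.
    have xE : x = x' by apply: ordvec_inj; apply/subr0_eq.
    rewrite xE in kk *; congr (_, _); apply: ordvec_inj; apply: (phi_inj phi_eq0).
    exact: addIr kk.
  have cfb : (#|fb| <= #|cl| * M ^ m.+1)%N.
    rewrite -(card_in_imset Finj).
    apply: (@leq_trans #|finset.setX cl [set: {ffun 'I_m.+1 -> 'I_M}]%SET|); last first.
      by rewrite cardsX cardsT card_ffun !card_ord.
    apply/subset_leq_card/fintype.subsetP => _ /imsetP [c cfb ->].
    move: cfb; rewrite !inE /= !andbT => /andP [tD /eqP [kc _]]; rewrite tD /=.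
    move/eqP: kc; rewrite eqr_div ?(qn0 _ tD) ?(qn0 _ t0D) // => /eqP e.
    by apply/eqP; rewrite mulrC e mulrC.
  apply: leq_trans (leq_mul cfb (leqnn _)) _.
  rewrite mulnAC; apply: leq_trans (leq_mul clP (leqnn _)) _.
  by rewrite -expnMn.
exists (undup [seq key c | c <- enum S]); split; first exact: undup_uniq.
  have := card_le_fibres fib; set k := size _ => le.
  have cS : #|S| = (#|D| * M1 ^ m.+1 * M2 ^ m.+1)%N.
    by rewrite !cardsX !cardsT !card_ffun !card_ord.
  have LM0 : (0 < (L * M) ^ m.+1)%N by rewrite expn_gt0 !muln_gt0 L0 K0 G0 s0.
  (* The auxiliary prime disappears here: [L ^ m.+1] occurs both in the number of directions and in
     the fibre bound. *)
  rewrite -(leq_pmul2l LM0).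
  apply: (@leq_trans (2 * (#|S| * (dirF A * f * (G * f)) ^ m.+1))); last first.
    apply: leq_trans (leq_mul (leqnn 2) le) _.
    have regroup Q : (2 * (k * (Q * L * M) ^ m.+1) = (L * M) ^ m.+1 * (2 * Q ^ m.+1 * k))%N.
      by rewrite !expnMn; ring.
    rewrite regroup.
    by rewrite leq_mul2l leq_mul2r leq_addr !orbT.
  rewrite cS.
  apply: (@leq_trans ((W * L) ^ m.+1 *
    (M1 ^ m.+1 * M2 ^ m.+1 * (dirF A * f * (G * f)) ^ m.+1))); last first.
    by apply: leq_trans (leq_mul cardD (leqnn _)) _; apply: eq_leq; ring.
  rewrite -!expnMn leq_exp2r //.
  have M2ge : (s * (f * W) <= M2)%N.
    rewrite (_ : M2 = (K * K * G) * (s * (f * W)))%N; last by rewrite /M2; ring.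
    by rewrite leq_pmull // !muln_gt0 K0.
  have ge1 : (f * f <= dirF A * f * (G * f))%N by rewrite leq_mul // leq_pmull.
  rewrite /M1.
  apply: (@leq_trans (W * L * (M * f * (s * (f * W)) * (f * f)))); last first.
    by rewrite leq_mul2l leq_mul ?orbT // leq_mul2l M2ge orbT.
  by apply: eq_leq; ring.
move=> u; rewrite mem_undup => /mapP [[[t x0] y0]]; rewrite mem_enum !inE /= !andbT => tD ->.
have [_ qb pb _] := dirP _ tD; have qt := qn0 _ tD.
pose px (v : {ffun 'I_m.+1 -> 'I_s}) := ordvec x0 + ordvec v *m mulmat A (q t).
pose py (v : {ffun 'I_m.+1 -> 'I_s}) := ordvec y0 + ordvec v *m mulmat A (p t).
exists (fun v => (phi (px v), phi (py v))); split.
  move=> v w [+ _]; rewrite !phiD !(phiM lamM) => /addrI/(mulIf qt)/(phi_inj phi_eq0).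
  exact: ordvec_inj.
move=> v; split.
  rewrite /slope_line /= !phiD !(phiM lamM).
  by field.
exists (px v), (py v); split => //.
- apply: bnd_le (bndD (bnd_ordvec _) (bnd_mulmat A (bnd_ordvec _) qb)).
  apply: (@leq_trans (2 * (K * K * G) * (s * f))); last by rewrite leq_mul2r leq_addl orbT.
  rewrite /M1 /M; apply: (@leq_trans (K * G * s * f + K * (s * (G * f)))).
    by rewrite leq_add2l leq_mul2r bK orbT.
  rewrite (_ : (_ + _ = 2 * (1 * K * G) * (s * f))%N); last by ring.
  by rewrite !leq_mul2r leq_mul2l leq_mul2r leq_mul2r K0 !orbT.

- apply: bnd_le (bndD (bnd_ordvec _) (bnd_mulmat A (bnd_ordvec _) pb)).
  apply: (@leq_trans (2 * (K * K * G) * (s * f * W))); last by rewrite leq_mul2r leq_addl orbT.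
  rewrite /M2; apply: (@leq_trans (K * K * (s * (G * f * W)) + K * (s * (K * (G * f * W))))).
    by rewrite leq_add2l leq_mul2r bK orbT.
  by apply: eq_leq; ring.
Qed.
End OrderLines.

(** * Choice of integer scales and conclusion *)

Lemma exists_nat_quotient (R : realType) (u v : R) : 0 < u -> u <= v ->
  exists n : nat, [/\ (0 < n)%N, u * n%:R <= v & v < 2 * (u * n%:R)].
Proof.
move=> u0 uv; have v0 : 0 <= v / u by rewrite divr_ge0 // ltW // (lt_le_trans u0).
(* Truncating a real number that is at least 1 loses less than a factor 2. *)
have /andP [] := truncn_itv v0; set n := Num.truncn _ => le lt.
have n0 : (0 < n)%N.
  rewrite lt0n; apply/eqP => n0; move: lt; rewrite n0 ltr_pdivrMr // mul1r.
  by rewrite ltNge uv.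
exists n; split => //; first by rewrite mulrC -ler_pdivlMr.
rewrite (_ : 2 * (u * n%:R) = (2 * n)%:R * u); last by rewrite natrM; ring.
rewrite -ltr_pdivrMr //; apply: lt_le_trans lt _; rewrite ler_nat; lia.
Qed.

(** For use with [rho = r^(1/d)], [x = n^(alpha/d)], [y = n^((1-alpha)/d)]. Both [D s f] and
    [D s f W] fill their boxes up to a factor 2, so [x < 6 D s f] and [y < 6 D s f W]; the last
    clause is the square of the product. *)
Lemma exists_scales (R : realType) (D : nat) (rho x y : R) : (0 < D)%N ->
  1 <= rho -> 6 * D%:R * rho <= x -> x <= y ->
  exists s f W : nat, [/\ [/\ (0 < s)%N, (0 < f)%N & (0 < W)%N],
    rho <= s%:R /\ s%:R <= 2 * rho,
    (D * (s * f))%:R <= x / 3, (D * (s * f * W))%:R <= y / 3 &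
    (x * y) ^+ 2 <= (6 * D%:R) ^+ 4 * s%:R ^+ 3 * (s * f ^ 4 * W ^ 2)%:R].
Proof.
move=> D0 rho1 le_x le_y.
have [n [n0 nle nlt]] := exists_nat_quotient ltr01 rho1.
(* Doubling rounds up: [s] must be at least [rho] for the lines to carry [r] points. *)
pose s := (2 * n)%N; have s0 : (0 < s)%N by rewrite muln_gt0.
have sE : s%:R = 2 * n%:R :> R by rewrite natrM.
have DR : 0 < D%:R :> R by rewrite ltr0n.
have Ds0 : 0 < (D * s)%:R :> R by rewrite ltr0n muln_gt0 D0.
have Dsx : (D * s)%:R <= x / 3.
  have : D%:R * (1 * n%:R) <= D%:R * rho by rewrite ler_pM2l.
  rewrite natrM sE; lra.
have [f [f0 fle flt]] := exists_nat_quotient Ds0 Dsx.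
have fE : (D * s)%:R * f%:R = (D * (s * f))%:R :> R by rewrite -natrM mulnA.
rewrite fE in fle flt.
have Df0 : 0 < (D * (s * f))%:R :> R by rewrite ltr0n !muln_gt0 D0 n0.
have Dfy : (D * (s * f))%:R <= y / 3 by lra.
have [W [W0 Wle Wlt]] := exists_nat_quotient Df0 Dfy.
have WE : (D * (s * f))%:R * W%:R = (D * (s * f * W))%:R :> R by rewrite -natrM -[in LHS]mulnA.
rewrite WE in Wle Wlt.
have rho_s : rho <= s%:R by rewrite sE; lra.
have s_rho : s%:R <= 2 * rho by rewrite sE; lra.
exists s, f, W; split => //.
set u := (D * (s * f))%:R in flt fle Df0; set w := (D * _)%:R in Wle Wlt.
have -> : (6 * D%:R) ^+ 4 * s%:R ^+ 3 * (s * f ^ 4 * W ^ 2)%:R = ((6 * u) * (6 * w)) ^+ 2.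
  by rewrite /u /w; ring.
have x0 : 0 < x by lra.
rewrite ler_pXn2r // ?nnegrE ?mulr_ge0 //; try by lra.
by apply: ler_pM; lra.
Qed.

Local Open Scope classical_set_scope.

Lemma card_le_inj (T : Type) (k : nat) (F : nat -> T) (B : set T) :
  (forall i j, (i < k)%N -> (j < k)%N -> F i = F j -> i = j) ->
  (forall i, (i < k)%N -> B (F i)) -> (`I_k #<= B)%card.
Proof.
move=> Finj FB.
have Finj' : {in `I_k &, injective F} by move=> i j; rewrite !inE; exact: Finj.
rewrite -(card_le_eql (inj_card_eq Finj')).
by apply: subset_card_le => _ [i ik <-]; apply: FB.
Qed.

Theorem theorem1p3 (R : realType) (d : nat) (lam : 'I_d -> R[i])
    (hd : (0 < d)%N) (hlam : nice_basis lam) :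
  exists C' c : R, 0 < C' /\ 0 < c /\
    forall (alpha : R) (n r : nat),
      0 < alpha -> alpha <= 1 / 2 ->
      (0 < n)%N -> (0 < r)%N ->
      r%:R <= C' * n%:R `^ alpha ->
      exists k : nat,
        c * n%:R ^+ 2 / r%:R ^+ 3 <= k%:R /\
        (`I_k #<= rich_lines r (boxA lam (n%:R `^ alpha) `*`
                                boxA lam (n%:R `^ (1 - alpha))))%card.
Proof.
case: d lam hd hlam => // m lam _ [indep prod].
have zcombE (x : 'rV[int]_m.+1) : zcomb lam (fun i => x 0 i) = phi lam x.
  by apply: eq_bigr => i _; rewrite mulrzl.
have phi_eq0 x : phi lam x = 0 -> x = 0.
  by rewrite -zcombE => /indep x0; apply/rowP => i; rewrite mxE.
have /choice [A lamM] (i : 'I_m.+1) : exists Ai : 'M[int]_m.+1,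
    forall j, lam i * lam j = phi lam (row j Ai).
  have /choice [a aP] := prod i.
  exists (\matrix_(j, k) a j k) => j; rewrite aP -zcombE.
  by apply: eq_bigr => k _; rewrite !mxE.
have [D [D0 rich_D]] := exists_rich_lines phi_eq0 lamM.
set d := m.+1; have d0 : d%:R != 0 :> R by rewrite pnatr_eq0.
have DR : 0 < D%:R :> R by rewrite ltr0n.
(* The first constant makes the bound on [r] the [d]-th power of [6 * D * rho <= x]. The second
   collects the loss in [exists_scales], the factor [2 ^ 3] from [s <= 2 * rho], and the [D] of
   [rich_D]. *)
exists ((6 * D%:R) ^- d), (((6 * D%:R) ^+ 4 * 2 ^+ 3) ^+ d * D%:R)^-1.
have C0 : 0 < (6 * D%:R) ^+ d :> R by rewrite exprn_gt0 // mulr_gt0.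
have c0 : 0 < ((6 * D%:R) ^+ 4 * 2 ^+ 3) ^+ d * D%:R :> R.
  by rewrite mulr_gt0 // exprn_gt0 // mulr_gt0 // exprn_gt0 // mulr_gt0.
split; first by rewrite invr_gt0.
split; first by rewrite invr_gt0.
move=> alpha n r alpha0 alpha_half n0 r0 r_le.
have n1 : 1 <= n%:R :> R by rewrite ler1n.
have powK (z : R) : 0 <= z -> (z `^ d%:R^-1) ^+ d = z.
  by move=> z0; rewrite -powR_mulrn ?powR_ge0 // -powRrM mulVf // powRr1.
pose rho : R := r%:R `^ d%:R^-1.
pose x : R := (n%:R `^ alpha) `^ d%:R^-1.
pose y : R := (n%:R `^ (1 - alpha)) `^ d%:R^-1.
have dV0 : 0 <= d%:R^-1 :> R by rewrite invr_ge0.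
have mono (u v : R) : 0 <= u -> u <= v -> u `^ d%:R^-1 <= v `^ d%:R^-1.
  by move=> u0 uv; apply: ge0_ler_powR => //; rewrite nnegrE // (le_trans u0).
have rho1 : 1 <= rho.
  by have := mono 1 r%:R ler01; rewrite powR1 ler1n; apply.
have xy : x <= y.
  by apply: mono; rewrite ?powR_ge0 // ler_powR //; lra.
have rho_x : 6 * D%:R * rho <= x.
  rewrite -(ler_pXn2r (ltn0Sn m)) ?nnegrE ?mulr_ge0 ?powR_ge0 // ?(ltW DR) //.
  rewrite exprMn !powK ?powR_ge0 //.
  by rewrite -ler_pdivlMl.
have [s [f [W [[s0 f0 W0] [rho_s s_rho] box1 box2 count_le]]]] :=
  exists_scales D0 rho1 rho_x xy.
have [us [us_uniq us_size us_rich]] := rich_D s f W s0 f0 W0.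
exists (size us); split.
  rewrite ler_pdivrMr ?exprn_gt0 ?ltr0n // mulrC ler_pdivrMr //.
  have xyn : (x * y) ^+ d = n%:R.
    rewrite exprMn !powK ?powR_ge0 // -powRD ?subrKC ?powRr1 //.
    by rewrite oner_eq0.
  (* This comparison converts the [s ^ 3] of [exists_scales] into the [r ^ 3] of the conclusion. *)
  have sr : (s%:R : R) ^+ d <= 2 ^+ d * r%:R.
    by rewrite -(powK r%:R) // -exprMn ler_pXn2r ?nnegrE ?mulr_ge0 ?powR_ge0.
  rewrite -xyn exprAC.
  apply: le_trans (_ : ((6 * D%:R) ^+ 4 * s%:R ^+ 3 * (s * f ^ 4 * W ^ 2)%:R) ^+ d <= _).
    by rewrite ler_pXn2r // nnegrE ?exprn_ge0 ?mulr_ge0 ?powR_ge0 // exprn_ge0.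
  set P := (6 * D%:R) ^+ 4; have P0 : 0 <= P by rewrite exprn_ge0 // mulr_ge0.
  rewrite 2!exprMn -(natrX _ (s * f ^ 4 * W ^ 2)%N).
  have Zle : ((s * f ^ 4 * W ^ 2) ^ d)%:R <= D%:R * (size us)%:R :> R.
    by rewrite -natrM ler_nat.
  have s3 : (s%:R ^+ 3) ^+ d <= (2 ^+ d * r%:R) ^+ 3 :> R.
    by rewrite exprAC ler_pXn2r // nnegrE ?mulr_ge0 ?exprn_ge0.
  apply: le_trans (ler_pM _ _ (ler_wpM2l _ s3) Zle) _; rewrite ?mulr_ge0 ?exprn_ge0 //.
  rewrite [(P * _) ^+ d]exprMn [(2 ^+ 3) ^+ d]exprAC.
  move: (2 ^+ d) (P ^+ d) => t p; rewrite le_eqVlt; apply/orP; left; apply/eqP; ring.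
apply: (@card_le_inj _ _ (fun i => slope_line (nth (0, 0) us i))).
  by move=> i j ik jk /slope_line_inj /eqP; rewrite nth_uniq // => /eqP.
move=> i ik; set u := nth _ us i; have [pt [pt_inj ptP]] := us_rich u (mem_nth _ ik).
split; first by exists (- u.1), 1, u.2; split => // -[_ /eqP]; rewrite oner_eq0.
have r_s : (r <= s ^ d)%N.
  rewrite -(ler_nat R) -(powK r%:R) // natrX ler_pXn2r // nnegrE ?powR_ge0 //.
pose v0 : {ffun 'I_d -> 'I_s} := [ffun=> Ordinal s0].
have sz : size (enum {: {ffun 'I_d -> 'I_s}}) = (s ^ d)%N.
  by rewrite -cardE card_ffun !card_ord.
have inbox (b : nat) (N : R) z : b%:R <= N -> bnd b z ->
    forall i, `|z 0 i|%:~R <= N :> R.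
  move=> bN /bndP zb k; apply: le_trans bN.
  by rewrite pmulrn ler_int.
apply: (@card_le_inj _ _ (fun j => pt (nth v0 (enum {: {ffun 'I_d -> 'I_s}}) j))).
  move=> j k jr kr /pt_inj /eqP; rewrite nth_uniq ?enum_uniq ?sz ?(leq_trans _ r_s) //.
  by move=> /eqP.
move=> j jr; have [on [z [w [ptE zb wb]]]] := ptP (nth v0 (enum {: {ffun 'I_d -> 'I_s}}) j).
split => //; rewrite ptE; split => /=.
  by exists (fun i => z 0 i); split; [exact: inbox zb|rewrite zcombE].
by exists (fun i => w 0 i); split; [exact: inbox wb|rewrite zcombE].
Qed.
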